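(* There is an absolute constant $\kappa>0$ such that for every integer $m\ge2$ there is a concept class $\mathcal C_m\subseteq\{0,1\}^{2^m}$ with $|\mathcal C_m|=m$ such that $$\mathsf R_{\mathrm{bool}}(\mathcal C_m)=1\qquad\text{but}\qquad \mathsf R(\mathcal C_m)\ge\kappa\log m .$$
   Context: A concept class is a set $\mathcal C\subseteq\{0,1\}^N$. A classical query at $i\in[N]$ to an unknown $c\in\mathcal C$ returns $c_i$; queries may be adaptive. For a function $f:\mathcal C\to E$, $\mathsf R(f)$ is the minimum worst-case number of queries of a randomized algorithm that, for every $c\in\mathcal C$, outputs $f(c)$ with probability at least $2/3$. $\mathsf R(\mathcal C)$ is the randomized query complexity of identifying the unknown concept, i.e. $\mathsf R(\mathcal C)=\mathsf R(\mathrm{Id})$ for the identity map $\mathrm{Id}:\mathcal C\to\mathcal C$. For $\mathcal P\subseteq\mathcal C$ let $b_{\mathcal P}:\mathcal C\to\{0,1\}$ be $b_{\mathcal P}(c)=\mathbf 1[c\in\mathcal P]$, and define $\mathsf R_{\mathrm{bool}}(\mathcal C)=\max_{\mathcal P\subseteq\mathcal C}\mathsf R(b_{\mathcal P})$. Logarithms are base 2. *)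

(* Defs.v *)
From mathcomp Require Import all_boot all_order all_algebra.
From mathcomp Require Import boolp reals exp.

Set Implicit Arguments.
Unset Strict Implicit.
Unset Printing Implicit Defensive.

Import Order.TTheory GRing.Theory Num.Theory.
Local Open Scope ring_scope.

Notation concept N := {ffun 'I_N -> bool}.

Inductive dtree (N : nat) (E : Type) : Type :=
| Output of E
| Query of 'I_N & dtree N E & dtree N E.

Arguments Output {N E}.
Arguments Query {N E}.

(* [Query i t0 t1] continues with [t0] on answer 0 and with [t1] on answer 1. *)
Fixpoint run (N : nat) (E : Type) (t : dtree N E) (c : concept N) : E :=
  match t with
  | Output e => e
  | Query i t0 t1 => if c i then run t1 c else run t0 c
  end.

Fixpoint queries (N : nat) (E : Type) (t : dtree N E) (c : concept N) : nat :=
  match t with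
  | Output _ => 0%N
  | Query i t0 t1 => (if c i then queries t1 c else queries t0 c).+1
  end.

(* A randomized algorithm is a probability distribution on deterministic
   adaptive algorithms. Finite support loses no generality: for finite N, and
   outputs in a finite set, there are finitely many trees of depth at most a
   given bound. *)
Record rand_alg (R : realType) (N : nat) (E : Type) : Type := RandAlg {
  ra_size : nat;
  ra_tree : 'I_ra_size -> dtree N E;
  ra_weight : 'I_ra_size -> R;
  ra_weight_ge0 : forall w, 0 <= ra_weight w;
  ra_weight_sum1 : \sum_w ra_weight w = 1
}.

Arguments ra_size {R N E}.
Arguments ra_tree {R N E}.
Arguments ra_weight {R N E}.

Definition prob_output (R : realType) (N : nat) (E : eqType)
    (A : rand_alg R N E) (c : concept N) (e : E) : R :=
  \sum_(w | run (ra_tree A w) c == e) ra_weight A w.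

(* A function on the class C is given by a function on all of {0,1}^N, of which
   only the values on C are used. *)
Definition rand_computes (R : realType) (N : nat) (E : eqType)
    (C : {set concept N}) (f : concept N -> E) (A : rand_alg R N E) : Prop :=
  forall c, c \in C -> 2 / 3 <= prob_output A c (f c).

Definition query_bound (R : realType) (N : nat) (E : Type)
    (C : {set concept N}) (A : rand_alg R N E) (q : nat) : Prop :=
  forall c, c \in C -> forall w, (queries (ra_tree A w) c <= q)%N.

Definition rand_computable_in (R : realType) (N : nat) (E : eqType)
    (C : {set concept N}) (f : concept N -> E) (q : nat) : bool :=
  `[< exists A : rand_alg R N E, rand_computes C f A /\ query_bound C A q >].

Fixpoint query_all (N : nat) (E : Type) (f : concept N -> E)
    (s : seq 'I_N) (g : concept N) : dtree N E :=
  if s is i :: s' then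
    Query i (query_all f s' [ffun j => if j == i then false else g j])
            (query_all f s' [ffun j => if j == i then true else g j])
  else Output (f g).

Lemma run_query_all (N : nat) (E : Type) (f : concept N -> E) s g c :
  run (query_all f s g) c = f [ffun j => if j \in s then c j else g j].
Proof.
elim: s g => [|i s IHs] g /=; first by congr f; apply/ffunP => j; rewrite ffunE.
case ci: (c i); rewrite IHs; congr f; apply/ffunP => j; rewrite !ffunE in_cons;
  by case: eqP => [->|_] /=; rewrite ?ci ?if_same.
Qed.

Lemma queries_query_all (N : nat) (E : Type) (f : concept N -> E) s g c :
  queries (query_all f s g) c = size s.
Proof. by elim: s g => [|i s IHs] g //=; case: (c i); rewrite IHs. Qed.

Lemma rand_computable_ex (R : realType) (N : nat) (E : eqType)
    (C : {set concept N}) (f : concept N -> E) :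
  exists q, rand_computable_in R C f q.
Proof.
pose t := query_all f (enum 'I_N) [ffun=> false].
have sum1 : \sum_(w < 1) (1 : R) = 1 by rewrite big_ord1.
exists N; apply/asboolP.
exists (RandAlg (fun _ : 'I_1 => t) (fun _ => ler01) sum1).
split=> c _; last by move=> w; rewrite /= queries_query_all size_enum_ord.
rewrite /prob_output /= big_ord1_cond run_query_all.
have -> : [ffun j => if j \in enum 'I_N then c j else [ffun=> false] j] = c.
  by apply/ffunP => j; rewrite ffunE mem_enum.
by rewrite eqxx ler_pdivrMr ?ltr0n // mul1r ler_nat.
Qed.

Definition rand_query (R : realType) (N : nat) (E : eqType)
    (C : {set concept N}) (f : concept N -> E) : nat :=
  ex_minn (rand_computable_ex R C f).

Definition rand_query_id (R : realType) (N : nat) (C : {set concept N}) : nat :=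
  rand_query R C id.

Definition indicator (N : nat) (P : {set concept N}) (c : concept N) : bool :=
  c \in P.

Definition rand_query_bool (R : realType) (N : nat) (C : {set concept N}) : nat :=
  \max_(P : {set concept N} | P \subset C) rand_query R C (indicator P).

Definition log2 (R : realType) (x : R) : R := ln x / ln 2.

(* Main.v *)
(** The class is the family of point functions of the m-element set [m],
    read against all its subsets: the concept of x maps S to 1[x \in S]. A
    boolean function of x is membership in some S, hence costs one query, and
    a nonconstant one cannot be computed without any. Conversely, a
    deterministic tree of depth q takes at most 2^q values on the class, so
    averaging over the class gives 2m/3 <= 2^q for any identification
    algorithm. *)

Require Import Defs.
From mathcomp Require Import all_boot all_order all_algebra.
From mathcomp Require Import boolp reals exp.

Set Implicit Arguments.
Unset Strict Implicit.
Unset Printing Implicit Defensive.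

Import Order.TTheory GRing.Theory Num.Theory.
Local Open Scope ring_scope.

(** By induction on the tree: the root query splits [C] by its answer, and each half is handled by a
    subtree with one query fewer left, so the bound doubles at each level. *)
Lemma card_run_imset (N : nat) (E : finType) (t : dtree N E)
    (C : {set concept N}) (q : nat) :
  (forall c, c \in C -> (queries t c <= q)%N) ->
  (#|[set run t c | c in C]| <= 2 ^ q)%N.
Proof.
elim: t C q => [e|i t0 IH0 t1 IH1] C q qC /=.
  rewrite (leq_trans _ (expn_gt0 2 q)) // -(cards1 e); apply: subset_leq_card.
  by apply/subsetP => _ /imsetP[c _ ->]; rewrite inE.
case: q qC => [|q] qC.
  (* A [Query] root spends a query on every concept, so a budget of 0 leaves no concept in [C]. *)
  suff -> : C = set0 by rewrite imset0 cards0.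
  by apply/setP => c; rewrite inE; apply/negP => /qC.
pose C0 := [set c : concept N in C | ~~ c i]; pose C1 := [set c : concept N in C | c i].
have sub : [set if c i then run t1 c else run t0 c | c : concept N in C]
    \subset [set run t0 c | c in C0] :|: [set run t1 c | c in C1].
  apply/subsetP => _ /imsetP[c cC ->]; rewrite inE.
  case ci: (c i); apply/orP; [right|left];
    by apply/imsetP; exists c; rewrite // inE cC ci.
apply: leq_trans (subset_leq_card sub) _.
apply: leq_trans (leq_card_setU _ _) _.
rewrite expnS mul2n -addnn leq_add //.
- apply: IH0 => c; rewrite inE => /andP[/qC /= + /negPf ci].
  by rewrite ci ltnS.
- apply: IH1 => c; rewrite inE => /andP[/qC /= + ci].
  by rewrite ci ltnS.
Qed.

Lemma rand_query_attained (R : realType) (N : nat) (E : eqType)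
    (C : {set concept N}) (f : concept N -> E) :
  exists A : rand_alg R N E,
    rand_computes C f A /\ query_bound C A (rand_query R C f).
Proof. by rewrite /rand_query; case: ex_minnP => q /asboolP. Qed.

Lemma rand_query_le (R : realType) (N : nat) (E : eqType)
    (C : {set concept N}) (f : concept N -> E) (t : dtree N E) (q : nat) :
  (forall c, c \in C -> run t c = f c) ->
  (forall c, c \in C -> (queries t c <= q)%N) ->
  (rand_query R C f <= q)%N.
Proof.
move=> tf tq; rewrite /rand_query; case: ex_minnP => q' _; apply.
have sum1 : \sum_(w < 1) (1 : R) = 1 by rewrite big_ord1.
apply/asboolP.
exists (RandAlg (fun _ : 'I_1 => t) (fun _ => ler01) sum1).
split=> [c cC|c cC w]; last exact: tq.
rewrite /prob_output /= big_ord1_cond tf // eqxx.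
by rewrite ler_pdivrMr ?ltr0n // mul1r ler_nat.
Qed.

(** Without queries every tree is a leaf, so the output distribution is the same on [c] and [d]. Two
    distinct values would each have probability at least 2/3, for a total of 4/3. *)
Lemma rand_query_gt0 (R : realType) (N : nat) (E : eqType)
    (C : {set concept N}) (f : concept N -> E) (c d : concept N) :
  c \in C -> d \in C -> f c != f d -> (0 < rand_query R C f)%N.
Proof.
move=> cC dC fcd; have [A [Af Aq]] := rand_query_attained R C f.
rewrite lt0n; apply/negP => /eqP q0; rewrite {}q0 in Aq.
have run_d w : run (ra_tree A w) d = run (ra_tree A w) c.
  by have := Aq c cC w; case: (ra_tree A w).
have : prob_output A c (f c) + prob_output A d (f d) <= 1.
  rewrite -(ra_weight_sum1 A) /prob_output !(big_mkcond (fun w => _ == _)) /=.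
  rewrite -big_split /=; apply: ler_sum => w _; rewrite run_d.
  have w0 := ra_weight_ge0 w.
  case: eqP => [->|_]; last by rewrite add0r; case: ifP.
  by rewrite (negPf fcd) addr0.
apply/negP; rewrite -ltNge; apply: lt_le_trans (lerD (Af c cC) (Af d dC)).
by rewrite -mulrDl ltr_pdivlMr ?ltr0n // mul1r -natrD ltr_nat.
Qed.

(** The sum over [C] of the success probabilities is estimated twice: concept by concept from below,
    and tree by tree from above. *)
Lemma card_le_rand_query_id (R : realType) (N : nat) (C : {set concept N}) :
  (2 * #|C| <= 3 * 2 ^ rand_query_id R C)%N.
Proof.
rewrite /rand_query_id; have [A [Af Aq]] := rand_query_attained R C id.
set q := rand_query R C id in Aq *.
have lower : 2 / 3 * #|C|%:R <= \sum_(c in C) prob_output A c c.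
  by rewrite mulr_natr -sumr_const; apply: ler_sum.
have upper : \sum_(c in C) prob_output A c c <= (2 ^ q)%:R.
  rewrite /prob_output (exchange_big_dep predT) //=.
  rewrite -[leRHS]mul1r -{1}(ra_weight_sum1 A) mulr_suml; apply: ler_sum => w _.
  rewrite sumr_const -[leLHS]mulr_natr ler_wpM2l ?ra_weight_ge0 // ler_nat.
  (* A concept that tree [w] identifies correctly is itself one of the outputs of that tree. *)
  apply: leq_trans (card_run_imset (fun c cC => Aq c cC w)).
  apply: subset_leq_card; apply/subsetP => c /andP[cC /eqP rc].
  by apply/imsetP; exists c.
rewrite -(ler_nat R) !natrM -ler_pdivrMl ?ltr0n // mulrA [_^-1 * _]mulrC.
exact: le_trans upper.
Qed.

Section PointFunctions.
Variable m : nat.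

Lemma card_subsets_ord : #|{set 'I_m}| = (2 ^ m)%N.
Proof. by rewrite -cardsT -powersetT card_powerset cardsT card_ord. Qed.

Definition subset_index (S : {set 'I_m}) : 'I_(2 ^ m) :=
  cast_ord card_subsets_ord (enum_rank S).

Definition point_concept (x : 'I_m) : concept (2 ^ m) :=
  [ffun i => x \in enum_val (cast_ord (esym card_subsets_ord) i)].

Definition point_class : {set concept (2 ^ m)} :=
  [set point_concept x | x in 'I_m].

Lemma point_conceptE x S : point_concept x (subset_index S) = (x \in S).
Proof. by rewrite ffunE /subset_index cast_ordK enum_rankK. Qed.

(** The coordinate of the singleton of [y] separates [y] from every other point. *)
Lemma point_concept_inj : injective point_concept.
Proof.
move=> x y xy; apply/eqP.
by rewrite -in_set1 -point_conceptE xy point_conceptE set11.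
Qed.

Lemma card_point_class : #|point_class| = m.
Proof. by rewrite (card_imset _ point_concept_inj) card_ord. Qed.

Lemma rand_query_indicator_le1 (R : realType) (P : {set concept (2 ^ m)}) :
  (rand_query R point_class (indicator P) <= 1)%N.
Proof.
(* Pulling [P] back to points gives the subset whose coordinate is the indicator of [P] on the
   class. *)
pose S := [set x | point_concept x \in P].
apply: (@rand_query_le _ _ _ _ _
  (Query (subset_index S) (Output false) (Output true))) => _ /imsetP[x _ ->] /=.
  by rewrite point_conceptE inE /indicator; case: (_ \in P).
by rewrite !if_same.
Qed.

Lemma rand_query_bool_point_class (R : realType) :
  (2 <= m)%N -> rand_query_bool R point_class = 1%N.
Proof.
move=> m2; apply/eqP; rewrite eqn_leq; apply/andP; split.
  by apply/bigmax_leqP => P _; apply: rand_query_indicator_le1.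
pose x := Ordinal (ltnW m2); pose y := Ordinal m2.
have xC : point_concept x \in point_class by apply: imset_f.
have yC : point_concept y \in point_class by apply: imset_f.
(* A singleton has a nonconstant indicator, since [x] and [y] are the distinct points 0 and 1. *)
pose P := [set point_concept x].
have PC : P \subset point_class by rewrite sub1set.
apply: (leq_trans _ (leq_bigmax_cond _ PC)).
by apply: (rand_query_gt0 R xC yC);
  rewrite /indicator !inE eqxx (inj_eq point_concept_inj).
Qed.

End PointFunctions.

Theorem theorem4p2 (R : realType) :
  exists kappa : R, 0 < kappa /\
    forall m : nat, (2 <= m)%N ->
      exists C : {set concept (2 ^ m)},
        [/\ #|C| = m,
            rand_query_bool R C = 1%N
          & kappa * log2 (m%:R : R) <= (rand_query_id R C)%:R].
Proof.
(* The factor 1/2 comes from the weakened bound [m <= 2 ^ (q * 2)] below. *)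
exists 2^-1; split; first by rewrite invr_gt0 ltr0n.
move=> m m2; exists (point_class m); split.
- exact: card_point_class.
- exact: rand_query_bool_point_class.
have := card_le_rand_query_id R (point_class m); rewrite card_point_class.
set q := rand_query_id R _ => mq.
(* With [q = 0] the counting bound would read [2 * m <= 3], against [2 <= m]. *)
have q0 : (0 < q)%N.
  rewrite lt0n; apply: contraTneq mq => ->.
  by rewrite -ltnNge muln1 (@leq_trans (2 * 2)) // leq_mul2l.
(* 3/2 <= 2 <= 2^q absorbs the constant lost to the success probability. *)
have m_le : (m <= 2 ^ (q * 2))%N.
  rewrite -(leq_pmul2l (ltn0Sn 1)); apply: leq_trans mq _.
  rewrite muln2 -addnn expnD mulnA leq_mul2r; apply/orP; right.
  case: q q0 => // q _; rewrite expnS mulnA.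
  by rewrite (leq_trans (leq_pmulr 3 (expn_gt0 2 q))) // leq_mul2r orbT.
have ln2 : 0 < ln 2 :> R by rewrite ln_gt0 // ltr1n.
(* Clearing denominators turns the goal into [m <= 2 ^ (q * 2)] under [ln]. *)
rewrite /log2 mulrA ler_pdivrMr // ler_pdivrMl ?ltr0n //.
rewrite mulrA -natrM mulnC mulr_natl -lnXn ?ltr0n // -natrX.
by rewrite ler_ln ?posrE ?ltr0n ?expn_gt0 ?ler_nat // (ltnW m2).
Qed.
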